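(* Let $\phi$ be a CNF formula over a set $X$ of Boolean variables, and let $(S, \chi)$ be a tree decomposition of the Gaifman graph of $\phi$ of width $w$. Then the tree-decomposition algorithm described in the context, on input $X$, $\phi$, $(S,\chi)$, returns a project-join tree of $\phi$ of width at most $w + 1$.
   Context: A CNF formula $\phi$ is a set of clauses; $\mathrm{vars}(c)$ is the set of variables appearing in clause $c$, and $\mathrm{vars}(\phi) = \bigcup_{c \in \phi} \mathrm{vars}(c)$. The Gaifman graph of $\phi$ has a vertex for each variable of $\phi$, and two vertices are adjacent if the corresponding variables appear together in some clause of $\phi$. A tree is a simple, connected, acyclic graph; $\mathcal{V}(T)$ denotes the set of nodes of a tree $T$, a leaf of $T$ is a node of degree one, and $\mathcal{L}(T)$ is the set of leaves of $T$. Nodes that are not leaves are called internal. In a tree with a distinguished root $r$, the set $\mathcal{C}(n)$ of children of a node $n$ consists of all nodes $n'$ adjacent to $n$ such that all paths from $n'$ to $r$ contain $n$. A tree decomposition $(S, \chi)$ of a graph $G$ is a tree $S$ with a labeling function $\chi : \mathcal{V}(S) \to 2^{\mathcal{V}(G)}$ such that every vertex of $G$ lies in some $\chi(n)$, both endpoints of every edge of $G$ lie together in some $\chi(n)$, and for all $n, o, p \in \mathcal{V}(S)$, if $o$ is on the path from $n$ to $p$, then $\chi(n) \cap \chi(p) \subseteq \chi(o)$. Its width is $\max_{n \in \mathcal{V}(S)} |\chi(n)| - 1$. A project-join tree of a CNF formula $\phi$ over $X$ is a tuple $(T, r, \gamma, \pi)$ where $T$ is a tree with root $r \in \mathcal{V}(T)$,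 $\gamma : \mathcal{L}(T) \to \phi$ is a bijection between the leaves of $T$ and the clauses of $\phi$, and $\pi : \mathcal{V}(T) \setminus \mathcal{L}(T) \to 2^X$ is a labeling function on internal nodes, such that: (1) $\{\pi(n) : n \in \mathcal{V}(T) \setminus \mathcal{L}(T)\}$ is a partition of $X$; (2) for each internal node $n$, variable $x \in \pi(n)$, and clause $c \in \phi$ such that $x$ appears in $c$, the leaf $\gamma^{-1}(c)$ is a descendant of $n$ in $T$. For a node $n$ of $T$: $\mathrm{vars}(n) = \mathrm{vars}(\gamma(n))$ if $n$ is a leaf, and $\mathrm{vars}(n) = \left(\bigcup_{o \in \mathcal{C}(n)} \mathrm{vars}(o)\right) \setminus \pi(n)$ if $n$ is internal. The size of $n$ is $|\mathrm{vars}(n)|$ if $n$ is a leaf and $|\mathrm{vars}(n) \cup \pi(n)|$ if $n$ is internal. The width of the project-join tree is the maximum size of its nodes. Tree-decomposition algorithm (input: a set $X$ of Boolean variables, a CNF formula $\phi$ over $X$, and a tree decomposition $(S, \chi)$ of the Gaifman graph of $\phi$): Start with an empty project-join tree $T$ and a global variable $found = \emptyset$ (the clauses of $\phi$ that have been added to $T$). The recursive procedure $\mathrm{Process}(n, \ell)$, for $n \in \mathcal{V}(S)$ and $\ell \subseteq X$ (variables that must not be projected out here), returns a set of nodes of $T$ as follows: - $clauses := \{c \in \phi : c \notin found \text{ and } \mathrm{vars}(c) \subseteq \chi(n)\}$; then $found := found \cup clauses$; - $children :=$ the set of newly created leaves of $T$, one leaf $p$ with $\gamma(p) = c$ for each $c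 \in clauses$, together with $\bigcup_{o \in \mathcal{C}(n)} \mathrm{Process}(o, \chi(n))$, where $\mathcal{C}(n)$ is the set of children of $n$ in the rooted tree $S$; - if $children = \emptyset$ or $\chi(n) \subseteq \ell$, return $children$; otherwise create a new internal node $o$ of $T$ with set of children $children$ and label $\pi(o) = \chi(n) \setminus \ell$, and return $\{o\}$. The algorithm lets $s$ be an arbitrary node of $S$, fixed as the root of $S$, lets $r$ be the only element of $\mathrm{Process}(s, \emptyset)$, and returns $(T, r, \gamma, \pi)$.
   Formalization: X is taken to be vars(φ) (else π cannot cover X); a leaf of T is a childless node (a root of degree one is internal); if χ(s)=∅, Process(s,∅) may not be a singleton, so there the claim is made only when a tree is returned. *)

(* Defs.v *)
From HB Require Import structures.
From mathcomp Require Import all_boot all_order all_algebra.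
From mathcomp Require Import boolp.
Set Implicit Arguments.
Unset Strict Implicit.
Unset Printing Implicit Defensive.

Section Trees.
Variables (V : finType) (e : rel V).

Definition acyclic : Prop := forall c : seq V, 2 < size c -> ~ ucycle e c.

Definition is_tree : Prop :=
  [/\ symmetric e, irreflexive e, forall x y : V, connect e x y & acyclic].

Definition simple_path (x : V) (q : seq V) (y : V) : Prop :=
  [/\ path e x q, uniq (x :: q) & last x q = y].

Definition children (r n : V) : {set V} :=
  [set m | e n m & `[< forall q : seq V, simple_path m q r -> n \in m :: q >]].

Definition descendant (r n m : V) : bool :=
  connect [rel a b | b \in children r a] n m.

(* Leaves of the tree rooted at r. A node is childless iff it has degree one
   and is not the root, or is the only node: a root of degree one is internal. *)
Definition leaf (r n : V) : bool := children r n == set0.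

End Trees.

Section TreeDecompositions.
Variables (V S : finType) (g : rel V) (eS : rel S) (chi : S -> {set V}).

Definition tree_decomposition : Prop :=
  [/\ is_tree eS,
      forall v : V, exists n : S, v \in chi n,
      forall u v : V, g u v -> exists n : S, (u \in chi n) && (v \in chi n)
    & forall (n p : S) (q : seq S), simple_path eS n q p ->
        forall o : S, o \in n :: q -> chi n :&: chi p \subset chi o].

(* An integer: the width is -1 when all the bags are empty. *)
Definition td_width : int := ((\max_(n : S) #|chi n|)%:Z - 1)%R.

End TreeDecompositions.

Section CNF.
Variable X : finType.

(* A literal (x, b) is x if b = true and its negation if b = false. *)
Definition clause : Type := {set X * bool}.

Definition cnf : Type := {set {set X * bool}}.

Definition clause_vars (c : clause) : {set X} := [set l.1 | l in c].

Definition cnf_vars (phi : cnf) : {set X} := \bigcup_(c in phi) clause_vars c.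

(* The vertices are the elements of X, hence the variables of phi exactly when
   cnf_vars phi = [set: X]. *)
Definition gaifman (phi : cnf) : rel X :=
  [rel x y | (x != y) &&
     [exists c in phi, (x \in clause_vars c) && (y \in clause_vars c)]].

(* The labelings are total: the values of pj_gamma on internal nodes and those
   of pj_pi on leaves are never used. *)
Record pjtree := PJTree {
  pj_node : finType;
  pj_edge : rel pj_node;
  pj_root : pj_node;
  pj_gamma : pj_node -> clause;
  pj_pi : pj_node -> {set X} }.

Section ProjectJoinTrees.
Variable P : pjtree.

Let C (n : pj_node P) : {set pj_node P} := children (@pj_edge P) (pj_root P) n.

Definition pj_leaves : {set pj_node P} :=
  [set n | leaf (@pj_edge P) (pj_root P) n].

Definition project_join_tree (phi : cnf) : Prop :=
  [/\ is_tree (@pj_edge P),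
      {in pj_leaves &, injective (@pj_gamma P)} /\
        [set pj_gamma n | n in pj_leaves] = phi,
      (* the pj_pi n, as a family indexed by the internal nodes, partition X:
         two internal nodes may not share the same label *)
      {in ~: pj_leaves &, injective (@pj_pi P)} /\
        partition [set pj_pi n | n in ~: pj_leaves] [set: X]
    & forall (n l : pj_node P) (x : X),
        n \notin pj_leaves -> x \in pj_pi n ->
        l \in pj_leaves -> x \in clause_vars (pj_gamma l) ->
        descendant (@pj_edge P) (pj_root P) n l].

(* The recursion goes down the rooted tree, so a depth of #|pj_node P| is
   enough to reach the leaves from any node. *)
Fixpoint pj_vars_rec (depth : nat) (n : pj_node P) : {set X} :=
  if depth is d.+1 then
    if n \in pj_leaves then clause_vars (pj_gamma n)
    else (\bigcup_(o in C n) pj_vars_rec d o) :\: pj_pi n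
  else set0.

Definition pj_vars (n : pj_node P) : {set X} :=
  pj_vars_rec #|{: pj_node P}| n.

Definition pj_size (n : pj_node P) : nat :=
  if n \in pj_leaves then #|pj_vars n| else #|pj_vars n :|: pj_pi n|.

Definition pj_width : nat := \max_(n : pj_node P) pj_size n.

End ProjectJoinTrees.

(* The tree under construction is a store: the node i of T is the i-th item,
   and an internal item lists its children. *)
Inductive pj_item :=
  | LeafItem of clause
  | NodeItem of {set X} & seq nat.

Record td_state := TDState { store : seq pj_item; found : {set clause} }.

Definition item_children (it : pj_item) : seq nat :=
  if it is NodeItem _ ch then ch else [::].

Definition item_gamma (it : pj_item) : clause :=
  if it is LeafItem c then c else set0.

Definition item_pi (it : pj_item) : {set X} :=
  if it is NodeItem p _ then p else set0.

Definition add_leaves (cs : {set clause}) (st : td_state) : seq nat * td_state :=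
  (iota (size (store st)) #|cs|,
   TDState (store st ++ [seq LeafItem c | c <- enum cs]) (found st :|: cs)).

Definition add_internal (p : {set X}) (ch : seq nat) (st : td_state) :
    seq nat * td_state :=
  ([:: size (store st)], TDState (rcons (store st) (NodeItem p ch)) (found st)).

Definition pjtree_of_store (s : seq pj_item) (r : 'I_(size s)) : pjtree :=
  let item (i : 'I_(size s)) := nth (LeafItem set0) s i in
  @PJTree 'I_(size s)
    [rel i j : 'I_(size s) | (val j \in item_children (item i))
                          || (val i \in item_children (item j))]
    r (fun i => item_gamma (item i)) (fun i => item_pi (item i)).

Section Algorithm.
Variables (phi : cnf) (S : finType) (chi : S -> {set X}).
(* sched n lists the children of n in the order in which they are processed. *)
Variable sched : S -> seq S.

(* Process(n, l): the set of returned nodes of T, and the updated global state. *)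
Fixpoint process (depth : nat) (n : S) (l : {set X}) (st : td_state) :
    seq nat * td_state :=
  if depth is d.+1 then
    let clauses :=
      [set c in phi | (c \notin found st) && (clause_vars c \subset chi n)] in
    let '(leaves, st1) := add_leaves clauses st in
    let '(nodes, st2) :=
      foldl (fun (acc : seq nat * td_state) (o : S) =>
               let '(ns, st') := process d o (chi n) acc.2 in
               (acc.1 ++ ns, st'))
            ([::], st1) (sched n) in
    let ch := leaves ++ nodes in
    if (ch == [::]) || (chi n \subset l) then (ch, st2)
    else add_internal (chi n :\: l) ch st2
  else ([::], st).

(* The depth #|S| is never exhausted, as the nested calls started at the root s
   of the tree S follow a path of S. The result is None when the set returned
   by Process(s, set0) is not a singleton. *)
Definition td_algorithm (s : S) : option pjtree :=
  let '(ns, st) := process #|S| s set0 (TDState [::] set0) in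
  if ns is [:: r] then
    omap (@pjtree_of_store (store st)) (insub r)
  else None.

End Algorithm.

End CNF.

(* Main.v *)
(* Root S at s. The subtrees of S split the work of Process: a variable of two
   sibling subtrees lies in the bag of their parent, and a clause, being a clique
   of the Gaifman graph, fits in some bag. So every clause becomes exactly one
   leaf, and x is projected out exactly once, at the topmost node of S whose bag
   contains x. To each node of T created by Process(n, l) one attaches a set B
   containing its set of variables, namely vars(c) for a leaf c and
   chi(n) :&: l for an internal node; then B :|: pi is at most a bag, which
   bounds the width. Since B is empty at the root, climbing from a leaf c with
   x in vars(c) meets a label containing x, so the labels cover X and the
   only label containing x sits above every leaf in which x occurs. *)
Require Import Defs.
From HB Require Import structures.
From mathcomp Require Import all_boot all_order all_algebra.
From mathcomp Require Import boolp zify.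
Set Implicit Arguments.
Unset Strict Implicit.
Unset Printing Implicit Defensive.

(** * Subtrees of a rooted tree *)

Section Subtrees.
Variables (V : finType) (e : rel V) (r : V).

(** Arbitrary walks are used instead of simple paths so that they can be cut and concatenated
    freely; [childE] shows that children are unaffected. *)
Definition subtree (n : V) : {set V} :=
  [set v | `[< forall q, path e v q -> last v q = r -> n \in v :: q >]].

Lemma subtreeP n v :
  reflect (forall q, path e v q -> last v q = r -> n \in v :: q)
          (v \in subtree n).
Proof. by rewrite inE; apply: asboolP. Qed.

Lemma subtree_refl n : n \in subtree n.
Proof. by apply/subtreeP => q _ _; rewrite mem_head. Qed.

Lemma subtree_root : subtree r = [set: V].
Proof.
apply/setP => v; rewrite !inE; apply/asboolP => q _ <-.
exact: mem_last.
Qed.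

Lemma childE n m : (m \in children e r n) = e n m && (m \in subtree n).
Proof.
rewrite inE; congr (_ && _); apply/asboolP/subtreeP => nm q.
  move=> pq lq; case: (shortenP pq) lq => q' pq' uq' sq' lq'.
  have := nm q' (And3 pq' uq' lq').
  by rewrite !inE => /orP[-> // | /sq' ->]; rewrite orbT.
by case=> pq _; apply: nm.
Qed.

Lemma subtree_trans a b c :
  b \in subtree a -> c \in subtree b -> c \in subtree a.
Proof.
move=> /subtreeP ba /subtreeP cb; apply/subtreeP => q pq lq.
have bq := cb q pq lq.
case/splitPl: bq pq lq => q1 q2 l1.
rewrite cat_path last_cat l1 => /andP[_ p2] l2.
have := ba q2 p2 l2; rewrite !inE mem_cat => /orP[/eqP -> | ->]; last first.
  by rewrite !orbT.
by rewrite orbA -in_cons -l1 mem_last.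
Qed.

Hypothesis tree_e : is_tree e.

Let esym : symmetric e. Proof. by case: tree_e. Qed.
Let eirr : irreflexive e. Proof. by case: tree_e. Qed.

Lemma tree_path u v : exists q, simple_path e u q v.
Proof.
case: tree_e => _ _ conn _; have /connectP[q pq ->] := conn u v.
by case/shortenP: pq => q' pq' uq' _; exists q'.
Qed.

(** On a simple path from [a] to [r], the part after [b] would have to meet [a] again. *)
Lemma subtree_antisym a b : b \in subtree a -> a \in subtree b -> a = b.
Proof.
move=> /subtreeP ba /subtreeP ab.
have [q [pq uq lq]] := tree_path a r.
have bq := ab q pq lq.
case/splitPl: bq pq uq lq => q1 q2 l1.
rewrite cat_path last_cat l1 => /andP[_ p2] uq l2.
have := ba q2 p2 l2; rewrite inE => /orP[/eqP // | aq2].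
by move: uq; rewrite /= mem_cat aq2 orbT.
Qed.

Lemma child_subtree n m : m \in children e r n -> subtree m \subset subtree n.
Proof.
rewrite childE => /andP[_ mn]; apply/subsetP => v vm.
exact: subtree_trans mn vm.
Qed.

Lemma parent_notin_subtree n m : m \in children e r n -> n \notin subtree m.
Proof.
rewrite childE => /andP[enm mn]; apply/negP => nm.
by move: enm; rewrite (subtree_antisym mn nm) eirr.
Qed.

(** Otherwise the walk, shortened to a simple path, closes up through [o] into a cycle. This is
    where acyclicity enters. *)
Lemma no_detour o u n q :
  e o u -> e o n -> path e u q -> last u q = n -> o \notin u :: q -> u = n.
Proof.
move=> eou eon pq lq oq; apply/eqP; apply: contraT => un.
case: (shortenP pq) lq => q' pq' uq' sq' lq'.
have oq' : o \notin u :: q'.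
  by apply: contra oq; rewrite !inE => /orP[-> // | /sq' ->]; rewrite orbT.
case: tree_e => _ _ _ acyc; case: (acyc (o :: u :: q')).
  by case: q' lq' {pq' uq' sq' oq'} => //= lq'; rewrite lq' eqxx in un.
by rewrite /ucycle /= rcons_path eou pq' lq' esym eon -/(uniq (u :: q')) oq'.
Qed.

(** Prolonged by a walk from [v] to [r] avoiding [m], the path must still meet [m]. What follows [m]
    must meet [n], and [no_detour] makes [n] the very next vertex. *)
Lemma subtree_exit n m u v q :
  m \in children e r n -> u \in subtree m -> v \notin subtree m ->
  simple_path e u q v -> (m \in u :: q) && (n \in u :: q).
Proof.
move=> mn um vm [pq uq lq].
have [q' [pq' lq' mq']] : exists q', [/\ path e v q', last v q' = r & m \notin v :: q'].
  move: vm; rewrite inE => /asboolPn; rewrite -existsNE => -[q'].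
  by move=> /not_implyP[? /not_implyP[? /negP ?]]; exists q'.
have muq : m \in u :: q.
  have := subtreeP _ _ um (q ++ q'); rewrite cat_path pq lq pq' last_cat lq.
  move=> /(_ isT lq'); rewrite inE mem_cat orbA -in_cons.
  case/orP=> // mq2; by rewrite inE mq2 orbT in mq'.
rewrite muq /=.
case/splitPl: muq pq uq lq => q1 q2 l1.
rewrite cat_path last_cat l1 -cat_cons cat_uniq => /andP[_ p2].
case/and3P=> _ dis uq2 l2.
case: q2 => [|w q3] in p2 dis uq2 l2 *.
  by rewrite -l2 /= mem_head in mq'.
have mw : m \notin w :: q3.
  by apply: contra dis => mw; apply/hasP; exists m => //; rewrite -l1 mem_last.
move: mn; rewrite childE => /andP[enm /subtreeP mn].
move: p2 => /= /andP[emw p3].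
have := mn (w :: q3 ++ q'); rewrite /= cat_path last_cat emw p3 [last w q3]l2.
rewrite pq' => /(_ isT lq').
rewrite inE => /orP[/eqP nm | nw]; first by rewrite nm eirr in enm.
suff <- : w = n by rewrite -cat_cons mem_cat mem_head orbT.
have mall : m \notin w :: q3 ++ q'.
  rewrite -cat_cons mem_cat negb_or mw /=.
  by move: mq'; rewrite inE negb_or => /andP[].
have pall : path e w (q3 ++ q') by rewrite cat_path p3 [last w q3]l2.
case/splitPl: nw pall mall => q4 q5 l4.
rewrite cat_path => /andP[p4 _]; rewrite -cat_cons mem_cat negb_or => /andP[m4 _].
by apply: (no_detour (o := m) (q := q4)) => //; rewrite esym.
Qed.

Lemma subtree_split n v :
  v \in subtree n ->
  v = n \/ exists2 m, m \in children e r n & v \in subtree m.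
Proof.
move=> /subtreeP vn; have [->|vNn] := eqVneq v n; [by left | right].
have [q [pq uq lq]] := tree_path v r.
have := vn q pq lq; rewrite inE eq_sym (negPf vNn) /= => nq.
case/splitPr: nq pq uq lq => q1 q2.
rewrite cat_path last_cat /= => /and3P[p1 en p2].
rewrite mem_cat cat_uniq => /and5P[vq uq1 dis _ _] l2.
have nq1 : n \notin v :: q1.
  rewrite inE negb_or eq_sym vNn /=.
  by apply: contra dis => nq1 /=; rewrite nq1.
(* The vertex just before [n] on the path towards the root is the required child. *)
set o := last v q1 in en.
have on : o \in subtree n.
  apply/subtreeP => q' pq' lq'.
  have := vn (q1 ++ q'); rewrite cat_path p1 pq' last_cat => /(_ isT lq').
  by rewrite -cat_cons mem_cat (negPf nq1) inE => /= ->; rewrite orbT.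
exists o; first by rewrite childE esym en.
apply/subtreeP => q' pq' lq'; apply: contraT => oq'.
have := vn q' pq' lq' => nq'.
case/splitPl: nq' pq' oq' {lq'} => q3 q4 l3.
rewrite cat_path -cat_cons mem_cat negb_or => /andP[p3 _] /andP[oq3 _].
case/lastP: q1 => [|q0 z] in p1 nq1 vq uq1 dis @o en on oq3 *.
  by rewrite mem_head in oq3.
have oz : o = z by rewrite /o last_rcons.
rewrite rcons_path in p1; case/andP: p1 => p0 euz.
have zq0 : z \notin v :: q0.
  move: uq1; rewrite rcons_uniq inE negb_or => /andP[-> _]; rewrite andbT.
  by apply: contra vq => /eqP->; rewrite mem_rcons mem_head.
(* Going back from the predecessor of [o] to [v], then along the walk that avoids [o], reaches [n]
   without meeting [o]. *)
have u_n : last v q0 = n.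
  apply: (no_detour (o := o) (q := rev (belast v q0) ++ q3)) => //.
  - by rewrite oz esym.
  - rewrite cat_path rev_path; apply/andP; split.
      by rewrite (eq_path (e' := e)).
    by rewrite -[X in path _ X]/(last _ _); case: (q0) => //= a q5; rewrite rev_cons last_rcons.
  - by rewrite last_cat; case: (q0) => //= a q5; rewrite rev_cons last_rcons.
  rewrite -cat_cons mem_cat negb_or; apply/andP; split; last first.
    by move: oq3; rewrite inE negb_or => /andP[].
  by rewrite -rev_rcons -lastI mem_rev oz.
by move: nq1; rewrite -rcons_cons mem_rcons inE negb_or -u_n mem_last andbF.
Qed.

(** A simple path from [v] to [m'] leaves the subtree of [m] through [m], and its part up to [m]
    already leaves that of [m'] through [m']: it would visit [m'] twice. *)
Lemma sibling_subtrees_disjoint n m m' v :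
  m \in children e r n -> m' \in children e r n ->
  v \in subtree m -> v \in subtree m' -> m = m'.
Proof.
(* Distinct siblings are not nested: a simple path from [n] to [r] would meet [b], then return to
   [n]. *)
have aux a b : a \in children e r n -> b \in children e r n ->
    a \in subtree b -> a = b.
  move=> an bn ab; apply/eqP; apply: contraT => aNb.
  have [q [pq uq lq]] := tree_path n r.
  have ean : e a n by move: an; rewrite childE esym => /andP[].
  have := subtreeP _ _ ab (n :: q); rewrite /= ean pq lq => /(_ isT erefl).
  rewrite inE eq_sym (negPf aNb) /= => bq.
  case/splitPl: bq pq uq lq => q1 q2 l1.
  rewrite cat_path last_cat l1 => /andP[_ p2] uq l2.
  move: (bn); rewrite childE => /andP[enb /subtreeP/(_ q2 p2 l2)].
  rewrite inE => /orP[/eqP nb | nq2]; first by rewrite nb eirr in enb.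
  by move: uq; rewrite /= mem_cat nq2 orbT.
move=> mn m'n vm vm'; apply/eqP; apply: contraT => mNm'.
have m'm : m' \notin subtree m.
  by apply: contra mNm' => /(aux _ _ m'n mn) ->.
have mm' : m \notin subtree m'.
  by apply: contra mNm' => /(aux _ _ mn m'n) ->.
have [q [pq uq lq]] := tree_path v m'.
have /andP[mq _] := subtree_exit mn vm m'm (And3 pq uq lq).
case/splitPl: mq pq uq lq => q1 q2 l1.
rewrite cat_path last_cat l1 -cat_cons cat_uniq => /andP[p1 _] /and3P[u1 dis _] l2.
have /andP[m'q1 _] := subtree_exit m'n vm' mm' (And3 p1 u1 l1).
case: q2 => [|w q2] in dis l2; first by rewrite /= in l2; rewrite l2 eqxx in mNm'.
case/hasP: dis; exists m' => //; by rewrite -l2 /= mem_last.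
Qed.

End Subtrees.

(** * Trees given by a parent relation *)

Section ParentRelation.
Variables (V : finType) (p : rel V) (r : V) (rk : V -> nat).
Hypothesis p_rk : forall a b, p a b -> rk b < rk a.
Hypothesis p_uniq : forall a b c, p a c -> p b c -> a = b.
Hypothesis p_ex : forall b, b != r -> exists a, p a b.
Hypothesis p_root : forall a, ~~ p a r.

Let e := [rel a b | p a b || p b a].

(** Ranks increase towards the root and are bounded by their maximum, which makes the induction well
    founded. *)
Lemma parent_ind (Q : V -> Prop) :
  Q r -> (forall a b, p a b -> Q a -> Q b) -> forall b, Q b.
Proof.
move=> Qr Qp b; have [k] := ubnP (\max_v rk v - rk b).
elim: k b => // k IH b; rewrite ltnS => bk.
have [-> //|/p_ex[a ab]] := eqVneq b r.
apply: (Qp a) => //; apply: IH.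
have := p_rk ab; have := leq_bigmax (F := rk) a; lia.
Qed.

Lemma parent_ascent b :
  exists q, [/\ path e b q, last b q = r & all (fun v => rk b <= rk v) (b :: q)].
Proof.
elim/parent_ind: b => [|a b ab [q [pq lq aq]]].
  by exists [::]; rewrite /= leqnn.
exists (a :: q); split; rewrite //= ?ab ?orbT // leqnn (ltnW (p_rk ab)) /=.
apply/allP => v vq; have /allP/(_ v) := aq.
rewrite inE vq orbT => /(_ isT); apply: leq_trans; exact: ltnW (p_rk ab).
Qed.

(** In a cycle, both neighbours of a vertex of least rank would be its parent, hence equal. *)
Lemma parent_is_tree : is_tree e.
Proof.
have esym : symmetric e by move=> a b; rewrite /= orbC.
have toroot b : connect e b r.
  by have [q [pq lq _]] := parent_ascent b; apply/connectP; exists q.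
split=> //.
- by move=> a /=; rewrite orbb; apply/negP => /p_rk; rewrite ltnn.
- move=> a b; apply: connect_trans (toroot a) _.
  by rewrite (sym_connect_sym esym) toroot.
move=> c sc uc.
have [v0 v0c] : exists v, v \in c by case: c sc {uc} => // v c _; exists v; rewrite mem_head.
case: (arg_minnP (P := mem c) rk v0c) => v vc vmin.
have [i c' rc] := rot_to vc.
have := uc; rewrite -(rot_ucycle i) rc /ucycle => /andP[].
have sc' : 2 < size (v :: c') by rewrite -rc size_rot.
have memc w : w \in c' -> rk v <= rk w.
  by move=> wc; apply: vmin; rewrite -[_ w]/(w \in c) -(mem_rot i) rc inE wc orbT.
case: c' => [|x c'] // in sc' memc rc *.
case/lastP: c' => [|c' z] // in sc' memc rc *.
rewrite /= !rcons_path last_rcons => /andP[evx /andP[_ ezv]].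
rewrite mem_rcons => /and3P[_ xz _].
have pxv : p x v.
  by move: evx => /orP[/p_rk|//]; rewrite ltnNge memc // mem_head.
have pzv : p z v.
  move: ezv => /orP[//|/p_rk]; rewrite ltnNge memc //.
  by rewrite inE mem_rcons mem_head orbT.
by rewrite (p_uniq pxv pzv) mem_head in xz.
Qed.

(** A walk leaves the descendants of [b] only through the edge from [b] to its parent, so a parent
    separates its child from the root. Conversely, the ascent from a parent avoids its child, by
    comparison of ranks. *)
Lemma parent_children a b : (b \in children e r a) = p a b.
Proof.
rewrite childE; apply/andP/idP => [[eab /subtreeP ab] | pab].
  case/orP: eab => // pba.
  have [q [pq lq /allP aq]] := parent_ascent b.
  by have := aq _ (ab q pq lq); rewrite leqNgt p_rk.
split; first by rewrite /= pab.
apply/subtreeP => q pq lq.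
have D_up u v : connect p b u -> u != b -> p v u -> connect p b v.
  move=> /connectP[q']; case/lastP: q' => [_ -> | q' z]; first by rewrite eqxx.
  rewrite rcons_path last_rcons => /andP[pq' pz] -> _ pvz.
  by rewrite (p_uniq pvz pz); apply/connectP; exists q'.
have rb : ~~ connect p b r.
  apply/negP => /connectP[q']; case/lastP: q' => [/= _ rb | q' z].
    by move: (p_root a); rewrite rb pab.
  rewrite rcons_path last_rcons => /andP[_ pz] rz.
  by move: (p_root (last b q')); rewrite rz pz.
suff: forall u, connect p b u -> path e u q -> last u q = r -> a \in q.
  by move=> /(_ b (connect0 _ _) pq lq) aq; rewrite inE aq orbT.
elim: q {pq lq} => [|v q IH] u bu /=; first by move=> _ ur; rewrite ur (negPf rb) in bu.
case/andP => euv pq lq; rewrite inE.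
case/orP: euv => [puv | pvu].
  by rewrite (IH v) ?orbT //; apply: connect_trans bu (connect1 puv).
have [ub|ub] := eqVneq u b.
  by rewrite ub in pvu; rewrite (p_uniq pab pvu) eqxx.
by rewrite (IH v) ?orbT //; apply: D_up bu ub pvu.
Qed.

Lemma parent_descendant a b : descendant e r a b = connect p a b.
Proof. by apply: eq_connect => x y /=; rewrite parent_children. Qed.

End ParentRelation.

(** * Tree decompositions *)

Section RootedDecompositions.
Variables (V S : finType) (g : rel V) (eS : rel S) (chi : S -> {set V}) (s : S).
Hypothesis hS : tree_decomposition g eS chi.

Let tree_eS : is_tree eS. Proof. by case: hS. Qed.

Definition bags (U : {set S}) : {set V} := \bigcup_(n in U) chi n.

(** The path from [u] to [v] crosses [n], where the running intersection property applies. *)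
Lemma bags_subtree_exit n m u v :
  m \in children eS s n -> u \in subtree eS s m -> v \notin subtree eS s m ->
  chi u :&: chi v \subset chi n.
Proof.
move=> mn um vm; have [q sq] := tree_path tree_eS u v.
have /andP[_ nq] := subtree_exit tree_eS mn um vm sq.
by case: hS => _ _ _ /(_ u v q sq n nq).
Qed.

(** A path from below [m] to [n] crosses [m]. This is the invariant needed by the recursive call on
    [m], whose forbidden set is [chi n]. *)
Lemma bags_subtree_parent n m :
  m \in children eS s n -> chi n :&: bags (subtree eS s m) \subset chi m.
Proof.
move=> mn; apply/subsetP => x; rewrite inE => /andP[xn /bigcupP[u um xu]].
have [q sq] := tree_path tree_eS u n.
have /andP[mq _] := subtree_exit tree_eS mn um (parent_notin_subtree tree_eS mn) sq.
case: hS => _ _ _ /(_ u n q sq m mq)/subsetP; apply.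
by rewrite inE xu.
Qed.

Lemma bags_siblings n m m' :
  m \in children eS s n -> m' \in children eS s n -> m != m' ->
  bags (subtree eS s m) :&: bags (subtree eS s m') \subset chi n.
Proof.
move=> mn m'n mNm'; apply/subsetP => x.
rewrite inE => /andP[/bigcupP[u um xu] /bigcupP[v vm' xv]].
apply: (subsetP (bags_subtree_exit (u := u) (v := v) mn um _)); last by rewrite inE xu.
apply: contra mNm' => vm.
by rewrite (sibling_subtrees_disjoint tree_eS mn m'n vm vm').
Qed.

(* The bag is that of a node whose subtree is minimal among those whose bags
   cover [K]. *)
Lemma clique_in_bag (K : {set V}) :
  {in K &, forall x y, x != y -> g x y} -> exists n, K \subset chi n.
Proof.
move=> clique; pose P n := K \subset bags (subtree eS s n).
have Ps : P s.
  rewrite /P subtree_root; apply/subsetP => x _.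
  by case: hS => _ /(_ x)[n xn] _ _; apply/bigcupP; exists n.
case: (arg_minnP (fun n => #|subtree eS s n|) Ps) => n /subsetP Pn nmin.
exists n; apply/subsetP => x xK; apply: contraT => xn.
have /bigcupP[u un xu] := Pn x xK.
case: (subtree_split tree_eS un) => [uE | [m mn um]]; first by rewrite -uE xu in xn.
(* By minimality of [n], the bags below [m] miss some [y] of [K]. *)
have /subsetPn[y yK ym] : ~~ P m.
  apply/negP => /nmin; rewrite leqNgt proper_card // properE child_subtree //=.
  apply/subsetPn; exists n; first exact: subtree_refl.
  exact: (parent_notin_subtree tree_eS mn).
(* As [x] is absent from [chi n], no bag outside the subtree of [m] contains it; a bag containing
   both [x] and [y] would then put [y] below [m]. *)
have xm v : x \in chi v -> v \in subtree eS s m.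
  move=> xv; apply: contraT => vm.
  case/negP: xn; apply: (subsetP (bags_subtree_exit mn um vm)).
  by rewrite inE xu.
have xy : x != y.
  apply: contra ym => /eqP <-; apply/bigcupP; by exists u.
case: hS => _ _ /(_ x y (clique x y xK yK xy))[v /andP[xv yv]] _.
by case/bigcupP: ym; exists v; first exact: xm.
Qed.

End RootedDecompositions.

(** * The forests built by the algorithm *)

Section StoreExtensions.
Variables (X : finType) (phi : cnf X) (S : finType) (chi : S -> {set X}).
Variable W : nat.
Implicit Types (U : {set S}) (l K : {set X}) (st : td_state X) (ns ch : seq nat).

Definition item_clauses (it : pj_item X) : seq (clause X) :=
  if it is LeafItem c then [:: c] else [::].

Definition covered U : {set clause X} :=
  [set c in phi | [exists n in U, clause_vars c \subset chi n]].

(** Phrased with positions because these are the node numbers of the forest. *)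
Lemma mem_flatten_map (T : Type) (T' : eqType) (f : T -> seq T') (x0 : T) s y :
  reflect (exists2 k, k < size s & y \in f (nth x0 s k)) (y \in flatten (map f s)).
Proof.
apply: (iffP flattenP) => [[A /(nthP [::])[k] kn <- yA] | [k kn yk]].
  by rewrite size_map in kn; exists k; rewrite // -(nth_map x0 [::]).
by exists (f (nth x0 s k)) => //; rewrite -(nth_map x0 [::]) // mem_nth ?size_map.
Qed.

(* [B i] bounds from above the set vars(i) of the node [i]. *)
Definition item_ok (lo : nat) (B : nat -> {set X}) (i : nat) (it : pj_item X) : bool :=
  match it with
  | LeafItem c => (clause_vars c \subset B i) && (#|B i| <= W)
  | NodeItem p ch =>
      [&& ch != [::], p != set0,
          all (fun j => (lo <= j < i) && (B j \subset B i :|: p)) ch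
        & #|B i :|: p| <= W]
  end.

(* Between the states [st] and [st'], the items [new] were added to the store;
   they form a forest with set of roots [ns], built from the nodes in [U]. *)
Record extends_by U l st ns st' (B : nat -> {set X}) (new : seq (pj_item X)) : Prop :=
  ExtendsBy {
    ext_store : store st' = store st ++ new;
    ext_forest : perm_eq (ns ++ flatten (map (@item_children X) new))
                         (iota (size (store st)) (size new));
    ext_ok : forall k, k < size new ->
      item_ok (size (store st)) B (size (store st) + k) (nth (LeafItem set0) new k);
    ext_roots : all (fun j => B j \subset l) ns;
    ext_found : found st' = found st :|: covered U;
    ext_uniq : uniq (flatten (map item_clauses new));
    ext_clauses : flatten (map item_clauses new) =i found st' :\: found st;
    ext_disjoint : pairwise (fun A B : {set X} => [disjoint A & B]) (map (@item_pi X) new);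
    ext_labels : all (fun A : {set X} => A \subset bags chi U :\: l) (map (@item_pi X) new) }.

(** By [ext_forest], each new index occurs exactly once, as a root or as a child: this gives
    existence and uniqueness of parents. By [ext_labels], labels avoid [l], which keeps those of
    sibling calls disjoint. *)
Definition extends U l st ns st' : Prop :=
  exists B new, extends_by U l st ns st' B new.

(** The item at [i] refers only to bounds at indices from [lo] to [i], so the bounds may be
    redefined elsewhere when forests are glued. *)
Lemma item_ok_eq lo lo' B B' i it :
  lo' <= lo <= i -> (forall j, lo <= j <= i -> B j = B' j) ->
  item_ok lo B i it -> item_ok lo' B' i it.
Proof.
case/andP=> lolo loi eB; have Bi : B i = B' i by apply: eB; rewrite loi leqnn.
case: it => [c | p ch] /=; rewrite Bi // => /and4P[-> -> /allP allch ->].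
rewrite andbT /=; apply/allP => j /allch /andP[/andP[loj ji]].
by rewrite eB ?loj ?(ltnW ji) // ji (leq_trans lolo loj).
Qed.

Lemma ext_root_bounds U l st ns st' B new j :
  extends_by U l st ns st' B new -> j \in ns ->
  size (store st) <= j < size (store st').
Proof.
move=> E jns; rewrite (ext_store E) size_cat -mem_iota -(perm_mem (ext_forest E)).
by rewrite mem_cat jns.
Qed.

(** Labels of both forests avoid [l], which contains every variable common to their bags, so they
    are disjoint. Clauses do not repeat, since the second forest takes only those not found
    before. *)
Lemma extends_cat U1 U2 l st ns1 st1 ns2 st2 :
  bags chi U1 :&: bags chi U2 \subset l ->
  extends U1 l st ns1 st1 -> extends U2 l st1 ns2 st2 ->
  extends (U1 :|: U2) l st (ns1 ++ ns2) st2.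
Proof.
move=> dis [B1 [new1 E1]] [B2 [new2 E2]].
have sz : size (store st1) = size (store st) + size new1.
  by rewrite (ext_store E1) size_cat.
(* The two bounds are glued at the first index of the second forest. *)
pose B i := if i < size (store st1) then B1 i else B2 i.
have bagsU : bags chi (U1 :|: U2) = bags chi U1 :|: bags chi U2.
  exact: bigcup_setU.
have fsub : found st \subset found st1 by rewrite (ext_found E1) subsetUl.
have fsub2 : found st1 \subset found st2 by rewrite (ext_found E2) subsetUl.
exists B, (new1 ++ new2); split.
- by rewrite (ext_store E2) (ext_store E1) catA.
- rewrite map_cat flatten_cat perm_catACA size_cat iotaD.
  by apply: perm_cat; [exact: ext_forest E1 | rewrite -sz; exact: ext_forest E2].
- move=> k; rewrite size_cat nth_cat => kn; case: ltnP => kn1.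
    apply: item_ok_eq (ext_ok E1 kn1); first by rewrite leqnn leq_addr.
    by move=> j /andP[_ jk]; rewrite /B sz (leq_ltn_trans jk) // ltn_add2l.
  have kn2 : k - size new1 < size new2 by rewrite ltn_subLR.
  rewrite -[k in size _ + k](subnKC kn1) addnA -sz.
  apply: item_ok_eq (ext_ok E2 kn2); first by rewrite sz !leq_addr.
  by move=> j /andP[jk _]; rewrite /B ltnNge jk.
- rewrite all_cat; apply/andP; split; apply/allP => j jn; rewrite /B.
    have /andP[_ j1] := ext_root_bounds E1 jn.
    rewrite j1; exact: (allP (ext_roots E1)) jn.
  have /andP[j1 _] := ext_root_bounds E2 jn.
  rewrite ltnNge j1; exact: (allP (ext_roots E2)) jn.
- rewrite (ext_found E2) (ext_found E1) -setUA; congr (_ :|: _).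
  apply/setP => c; rewrite !inE; case: (c \in phi) => //=.
  apply/orP/exists_inP => [[] /exists_inP[n nU cn] | [n]].
  + by exists n => //; rewrite inE nU.
  + by exists n => //; rewrite inE nU orbT.
  + by rewrite inE => /orP[nU | nU] cn; [left | right]; apply/exists_inP; exists n.
- rewrite map_cat flatten_cat cat_uniq (ext_uniq E1) (ext_uniq E2) andbT /=.
  apply/hasPn => c; rewrite (ext_clauses E2) inE => /andP[c1 _].
  by rewrite (ext_clauses E1) inE negb_and c1 orbT.
- move=> c; rewrite map_cat flatten_cat mem_cat (ext_clauses E1) (ext_clauses E2) !inE.
  have /implyP := subsetP fsub c; have /implyP := subsetP fsub2 c.
  by case: (c \in found st); case: (c \in found st1); case: (c \in found st2).
- rewrite map_cat pairwise_cat (ext_disjoint E1) (ext_disjoint E2) !andbT.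
  apply/allrelP => a b /(allP (ext_labels E1)) sa /(allP (ext_labels E2)) sb.
  rewrite -setI_eq0 -subset0; apply/subsetP => x; rewrite inE.
  case/andP=> /(subsetP sa); rewrite inE => /andP[xl x1] /(subsetP sb).
  rewrite inE => /andP[_ x2]; case/negP: xl; apply: (subsetP dis).
  by rewrite inE x1.
- rewrite map_cat all_cat bagsU; apply/andP; split; apply/allP => a.
    move/(allP (ext_labels E1)) => sa; apply: subset_trans sa _.
    by rewrite setSD // subsetUl.
  move/(allP (ext_labels E2)) => sa; apply: subset_trans sa _.
  by rewrite setSD // subsetUr.
Qed.

(** The bound of a leaf is exactly the variable set of its clause, which fits in [chi n]. Counting
    clauses already found does not change the union, so [found] grows by all of [covered]. *)
Lemma extends_add_leaves n st :
  let cs := [set c in phi | (c \notin found st) && (clause_vars c \subset chi n)] in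
  #|chi n| <= W ->
  extends [set n] (chi n) st (add_leaves cs st).1 (add_leaves cs st).2.
Proof.
move=> cs nW.
pose B i := clause_vars (nth set0 (enum cs) (i - size (store st))).
have csn c : c \in enum cs -> clause_vars c \subset chi n.
  by rewrite mem_enum inE => /and3P[].
have flat : flatten (map item_clauses [seq LeafItem c | c <- enum cs]) = enum cs.
  by elim: (enum cs) => //= c q ->.
have cov : found st :|: cs = found st :|: covered [set n].
  apply/setP => c; rewrite !inE; case: (c \in found st) => //=.
  case: (c \in phi) => //=; apply/idP/exists_inP => [cn | [m]].
    by exists n; rewrite ?inE.
  by rewrite inE => /eqP ->.
exists B, [seq LeafItem c | c <- enum cs]; split => //=.
- rewrite size_map -cardE.
  have -> : flatten (map (@item_children X) [seq LeafItem c | c <- enum cs]) = [::].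
    by elim: (enum cs).
  by rewrite cats0.
- move=> k; rewrite size_map => kc; rewrite (nth_map set0) //= /B addKn subxx /=.
  by apply: leq_trans nW; apply: subset_leq_card; apply: csn; apply: mem_nth.
- apply/allP => j; rewrite mem_iota => /andP[j1 j2]; apply: csn; apply: mem_nth.
  by rewrite -cardE ltn_subLR.
- by rewrite flat enum_uniq.
- by move=> c; rewrite flat mem_enum !inE; case: (c \in found st) => //=; rewrite andbF.
- elim: (enum cs) => //= c q ->; rewrite andbT; apply/allP => A _.
  by rewrite disjoints_subset sub0set.
- by elim: (enum cs) => //= c q ->; rewrite sub0set.
Qed.

(** This is the case where no internal node is created. Labels avoid [K], and a variable of [l] met
    in the bags of [U] lies in [K], so they avoid [l] too. *)
Lemma extends_weaken U K l st ch st' :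
  l :&: bags chi U \subset K -> (ch == [::]) || (K \subset l) ->
  extends U K st ch st' -> extends U l st ch st'.
Proof.
move=> lK chK [B [new E]]; exists B, new; case: E => ? ? ? roots ? ? ? ? labels; split=> //.
  case/orP: chK => [/eqP -> //| Kl]; apply: sub_all _ roots => j jK.
  exact: subset_trans jK Kl.
apply: sub_all _ labels => it /subsetP sit; apply/subsetP => x /sit.
rewrite !inE => /andP[xK xU]; rewrite xU andbT; apply: contra xK => xl.
by apply: (subsetP lK); rewrite inE xl.
Qed.

(** The new node gets bound [K :&: l] and label [K :\: l], whose union is exactly [K]. Older labels
    avoid [K], hence are disjoint from this one. *)
Lemma extends_add_internal U K l st ch st' :
  l :&: bags chi U \subset K -> K \subset bags chi U -> #|K| <= W ->
  ch != [::] -> ~~ (K \subset l) ->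
  extends U K st ch st' ->
  extends U l st (add_internal (K :\: l) ch st').1 (add_internal (K :\: l) ch st').2.
Proof.
move=> lK KU KW ch0 Kl [B [new E]].
have sz : size (store st') = size (store st) + size new.
  by rewrite (ext_store E) size_cat.
pose B' i := if i < size (store st') then B i else K :&: l.
have KE : K :&: l :|: K :\: l = K by exact: setID.
exists B', (rcons new (NodeItem (K :\: l) ch)); split => //=.
- by rewrite (ext_store E) rcons_cat.
(* The former roots [ch] become children of the new item, whose index is now the only root. *)
- rewrite map_rcons flatten_rcons size_rcons -addn1 iotaD -sz /=.
  rewrite perm_sym perm_catC /= perm_cons perm_sym perm_catC.
  exact: ext_forest E.
- move=> k; rewrite size_rcons ltnS leq_eqVlt nth_rcons => /orP[/eqP -> | kn].
    rewrite ltnn eqxx /= -sz ch0 setD_eq0 Kl /= {2 3}/B' ltnn KE KW andbT.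
    apply/allP => j jch; have /andP[-> jst] := ext_root_bounds E jch.
    by rewrite jst /B' jst (allP (ext_roots E)).
  rewrite kn; apply: item_ok_eq (ext_ok E kn); first by rewrite leqnn leq_addr.
  by move=> j /andP[_ jk]; rewrite /B' sz (leq_ltn_trans jk) // ltn_add2l.
- by rewrite /B' ltnn subsetIr.
- exact: ext_found E.
- by rewrite map_rcons flatten_rcons cats0; exact: ext_uniq E.
- by move=> c; rewrite map_rcons flatten_rcons cats0; exact: (ext_clauses E c).
- rewrite map_rcons pairwise_rcons (ext_disjoint E) andbT; apply/allP => it.
  move/(allP (ext_labels E)) => /subsetP sit.
  rewrite -setI_eq0 -subset0; apply/subsetP => x.
  by rewrite !inE => /and3P[/sit]; rewrite inE => /andP[/negPf ->].
- rewrite map_rcons all_rcons /= setSD //=; apply: sub_all _ (ext_labels E) => it.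
  move/subsetP => sit; apply/subsetP => x /sit.
  rewrite !inE => /andP[xK xU]; rewrite xU andbT; apply: contra xK => xl.
  by apply: (subsetP lK); rewrite inE xl.
Qed.

(** Loop invariant over the subtrees processed so far; [lv] holds the leaves created beforehand, and
    [ns0] varies in the induction. *)
Lemma extends_fold (f : S -> td_state X -> seq nat * td_state X) (D : S -> {set S})
    l (os : seq S) U st lv ns0 st0 :
  (forall o st, o \in os -> extends (D o) l st (f o st).1 (f o st).2) ->
  (forall o, o \in os -> bags chi U :&: bags chi (D o) \subset l) ->
  pairwise (fun o o' => bags chi (D o) :&: bags chi (D o') \subset l) os ->
  extends U l st (lv ++ ns0) st0 ->
  let F := foldl (fun (acc : seq nat * td_state X) (o : S) =>
               let '(ns, st') := f o acc.2 in (acc.1 ++ ns, st')) (ns0, st0) os in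
  extends (U :|: \bigcup_(o <- os) D o) l st (lv ++ F.1) F.2.
Proof.
elim: os U ns0 st0 => [|o os IH] U ns0 st0 hf hU; first by rewrite big_nil setU0.
rewrite big_cons setUA => /= /andP[/allP dis pw] E.
have := hf o st0 (mem_head _ _); case: (f o st0) => ns1 st1 /= E1.
apply: IH => //.
- by move=> o' st' o's; apply: hf; rewrite inE o's orbT.
- move=> o' o's; rewrite [bags _ (_ :|: _)]bigcup_setU setIUl subUset dis // andbT.
  by apply: hU; rewrite inE o's orbT.
by rewrite catA; apply: extends_cat E E1; apply: hU; rewrite mem_head.
Qed.

(** A last new item could be neither a root nor a child, since children precede their parent; so
    nothing was added. *)
Lemma extends_no_root U l st st' :
  extends U l st [::] st' -> store st' = store st.
Proof.
case=> B [new E]; case/lastP: new E => [|new it] E.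
  by rewrite (ext_store E) cats0.
have := perm_mem (ext_forest E) (size (store st) + size new).
rewrite mem_iota leq_addr size_rcons addnS leqnn /=.
case/(mem_flatten_map _ (LeafItem set0)) => k kn lch.
have := ext_ok E kn; case: nth lch => //= p ch' lch /and4P[_ _ /allP/(_ _ lch)].
by move: kn; rewrite size_rcons; lia.
Qed.

End StoreExtensions.

(** * Correctness of the recursive procedure *)

Section Process.
Variables (X : finType) (phi : cnf X) (S : finType) (eS : rel S) (chi : S -> {set X}).
Variables (s : S) (sched : S -> seq S).
Hypothesis hS : tree_decomposition (gaifman phi) eS chi.
Hypothesis hsched : forall n, perm_eq (sched n) (enum (children eS s n)).

Let W := \max_n #|chi n|.
Let D := subtree eS s.
Let tree_eS : is_tree eS. Proof. by case: hS. Qed.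

Let mem_sched n o : (o \in sched n) = (o \in children eS s n).
Proof. by rewrite (perm_mem (hsched n)) mem_enum. Qed.

Lemma sched_subtree n : [set n] :|: \bigcup_(o <- sched n) D o = D n.
Proof.
apply/setP => v; rewrite in_setU in_set1 bigcup_seq; apply/orP/idP.
  case=> [/eqP -> | /bigcupP[o]]; first exact: subtree_refl.
  by rewrite mem_sched => /child_subtree/subsetP; apply.
move=> /(subtree_split tree_eS)[-> | [o on vo]]; first by left.
by right; apply/bigcupP; exists o; rewrite ?mem_sched.
Qed.

(** The second hypothesis says that forbidden variables occurring below [n] lie in its bag; labels
    created by the calls on children avoid [chi n], hence avoid them as well. *)
Lemma process_extends d n l st :
  #|D n| <= d -> l :&: bags chi (D n) \subset chi n ->
  extends phi chi W (D n) l st (process phi chi sched d n l st).1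
                               (process phi chi sched d n l st).2.
Proof.
elim: d n l st => [|d IH] n l st.
  by rewrite leqn0 cards_eq0 => /eqP D0; have := subtree_refl eS s n; rewrite -/D D0 inE.
move=> Dn lD; have nW : #|chi n| <= W by exact: leq_bigmax.
have bags1 : bags chi [set n] = chi n by exact: big_set1.
(* The appended empty list is the initial accumulator of the fold. *)
have leaves := extends_add_leaves phi st nW; rewrite -[_.1]cats0 in leaves.
have rec o st' : o \in sched n ->
    extends phi chi W (D o) (chi n) st' (process phi chi sched d o (chi n) st').1
                                        (process phi chi sched d o (chi n) st').2.
  rewrite mem_sched => on; apply: IH; last exact: (bags_subtree_parent hS on).
  (* The subtree of a child is strictly smaller, as it lacks [n], so the remaining depth
     suffices. *)
  rewrite -ltnS; apply: leq_trans Dn; apply: proper_card.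
  rewrite properE child_subtree //; apply/subsetPn.
  by exists n; [exact: subtree_refl | exact: (parent_notin_subtree tree_eS on)].
have sep o : o \in sched n -> bags chi [set n] :&: bags chi (D o) \subset chi n.
  by rewrite bags1 subsetIl.
have dis : pairwise (fun o o' => bags chi (D o) :&: bags chi (D o') \subset chi n) (sched n).
  have us : uniq (sched n) by rewrite (perm_uniq (hsched n)) enum_uniq.
  have sub o : o \in sched n -> o \in children eS s n by rewrite mem_sched.
  elim: (sched n) us sub => //= o os IHos /andP[oos uos] sub.
  rewrite IHos // ?andbT; last by move=> o' o's; apply: sub; rewrite inE o's orbT.
  apply/allP => o' o's; apply: (bags_siblings hS (s := s)).
  - by apply: sub; rewrite mem_head.
  - by apply: sub; rewrite inE o's orbT.
  - by apply: contra oos => /eqP ->.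
have := extends_fold (f := fun o => process phi chi sched d o (chi n)) rec sep dis leaves.
rewrite sched_subtree /=; case: foldl => nodes st2 /= E.
have nD : chi n \subset bags chi (D n) by apply: bigcup_sup; exact: subtree_refl.
case: ifP => [chl | /norP[ch0 nl]]; first exact: extends_weaken E.
exact: extends_add_internal E.
Qed.

(** The variables of a clause form a clique of the Gaifman graph. *)
Lemma covered_bags : covered phi chi [set: S] = phi.
Proof.
apply/setP => c; rewrite inE; case: (boolP (c \in phi)) => //= cphi.
apply/existsP; have [|n cn] := @clique_in_bag _ _ _ _ _ s hS (clause_vars c).
  by move=> x y xc yc xy; rewrite /gaifman /= xy; apply/exists_inP; exists c; rewrite // xc.
by exists n; rewrite inE.
Qed.

Lemma process_root :
  extends phi chi W [set: S] set0 (TDState [::] set0)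
    (process phi chi sched #|S| s set0 (TDState [::] set0)).1
    (process phi chi sched #|S| s set0 (TDState [::] set0)).2.
Proof.
rewrite -(subtree_root eS s); apply: process_extends; last by rewrite set0I sub0set.
by apply: max_card.
Qed.

Lemma process_roots d n (l : {set X}) st :
  ~~ (chi n \subset l) -> size (process phi chi sched d n l st).1 <= 1.
Proof.
case: d => [|d] nl //=; case: foldl => nodes st2.
by rewrite (negPf nl) orbF; case: eqP => [->|].
Qed.

(** A nonempty root bag forces at most one root. It also supplies a variable, hence a clause of
    [phi]; without a root the store would be empty and this clause would have no leaf. *)
Lemma td_algorithm_some :
  cnf_vars phi = [set: X] -> chi s != set0 ->
  exists P : pjtree X, td_algorithm phi chi sched s = Some P.
Proof.
move=> hX s0; rewrite /td_algorithm.
have := process_root.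
have := @process_roots #|S| s set0 (TDState [::] set0); rewrite subset0 => /(_ s0).
case: process => [[|r [|//]] st] /= _ E; last first.
  case: insubP => [r' _ _ | /negP[]]; first by exists (pjtree_of_store r').
  by case: E => B [new] /ext_root_bounds/(_ (mem_head _ _))/andP[].
have [x _] := set0Pn _ s0.
have : x \in cnf_vars phi by rewrite hX.
case/bigcupP => c cphi _.
have st0 := extends_no_root E; case: E => B [new E].
have := ext_clauses E c; rewrite (ext_found E) covered_bags !inE cphi /=.
by have := ext_store E; rewrite st0 /= => <-.
Qed.

End Process.

(** Applied to child lists for the uniqueness of parents, and to clause lists for the injectivity of
    [pj_gamma]. *)
Lemma uniq_flatten_map (T : Type) (T' : eqType) (f : T -> seq T') (x0 : T) q y k k' :
  uniq (flatten (map f q)) -> k < size q -> k' < size q ->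
  y \in f (nth x0 q k) -> y \in f (nth x0 q k') -> k = k'.
Proof.
elim: q k k' => //= a q IH [|k] [|k'] //=; rewrite cat_uniq => /and3P[_ dis uq] kq k'q yk yk'.
- by case/hasP: dis; exists y => //; apply/(mem_flatten_map _ x0); exists k'.
- by case/hasP: dis; exists y => //; apply/(mem_flatten_map _ x0); exists k.
- by rewrite (IH _ _ uq kq k'q yk yk').
Qed.

(** * The output is a project-join tree of bounded width *)

Section OutputTree.
Variables (X : finType) (phi : cnf X) (S : finType) (chi : S -> {set X}) (W : nat).
Variables (st : td_state X) (r : 'I_(size (store st))).
Variable B : nat -> {set X}.
Hypothesis E :
  extends_by phi chi W [set: S] set0 (TDState [::] set0) [:: val r] st B (store st).
Hypothesis cov : covered phi chi [set: S] = phi.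
Hypothesis hX : cnf_vars phi = [set: X].

Let P := pjtree_of_store r.
Let item (i : 'I_(size (store st))) := nth (LeafItem set0) (store st) i.
Let p : rel 'I_(size (store st)) := [rel i j | val j \in item_children (item i)].

Let item_okP (i : 'I_(size (store st))) : item_ok W 0 B i (item i).
Proof. exact: (ext_ok E (ltn_ord i)). Qed.

Let uniq_children : uniq (val r :: flatten (map (@item_children X) (store st))).
Proof. by rewrite (perm_uniq (ext_forest E)) iota_uniq. Qed.

(** The rank of a node is its index: children are created before their parent. *)
Let p_rk a b : p a b -> val b < val a.
Proof.
rewrite /p /=; have := item_okP a; case: (item a) => //= A ch /and4P[_ _ /allP chok _].
by move=> /chok /andP[].
Qed.

Let p_uniq a b c : p a c -> p b c -> a = b.
Proof.
move=> ac bc; apply/val_inj; case/andP: uniq_children => _ uf.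
exact: (uniq_flatten_map uf (ltn_ord a) (ltn_ord b) ac bc).
Qed.

Let p_ex b : b != r -> exists a, p a b.
Proof.
move=> br; have : val b \in iota 0 (size (store st)) by rewrite mem_iota ltn_ord.
rewrite -(perm_mem (ext_forest E)) inE (negPf br : (val b == val r) = false) /=.
by case/(mem_flatten_map _ (LeafItem set0)) => k kn bk; exists (Ordinal kn).
Qed.

Let p_root a : ~~ p a r.
Proof.
apply/negP => ar; case/andP: uniq_children => /negP rn _; apply: rn.
by apply/(mem_flatten_map _ (LeafItem set0)); exists (val a); [exact: ltn_ord | exact: ar].
Qed.

Let childrenE (a b : pj_node P) :
  (b \in children (@pj_edge X P) (pj_root P) a) = p a b.
Proof. exact: (parent_children p_rk p_uniq p_ex p_root). Qed.

(** Internal items list at least one child, so being childless identifies the leaf items. *)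
Let leavesE (i : pj_node P) :
  (i \in pj_leaves P) = if item i is LeafItem _ then true else false.
Proof.
rewrite inE; apply/eqP/idP => [ch0 | ].
  have := item_okP i; case iE: (item i) => //= [A ch] /and4P[chn _ /allP chok _].
  case: ch chn chok iE => // j ch _ /(_ j (mem_head _ _))/andP[ji _] iE.
  have := childrenE i (Ordinal (ltn_trans ji (ltn_ord i))).
  by rewrite ch0 /p /= iE !inE eqxx.
move=> li; apply/setP => j; rewrite childrenE /p inE /=.
by case: (item i) li.
Qed.

Let item_leaf (i : pj_node P) : i \in pj_leaves P -> item i = LeafItem (pj_gamma i).
Proof. by rewrite leavesE /= -/(item i); case: (item i). Qed.

Let item_internal (i : pj_node P) :
  i \notin pj_leaves P -> exists ch, item i = NodeItem (pj_pi i) ch.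
Proof. by rewrite leavesE /= -/(item i); case: (item i) => // A ch; exists ch. Qed.

Let internal_label (i : pj_node P) x : x \in pj_pi i -> i \notin pj_leaves P.
Proof. by rewrite leavesE /= -/(item i); case: (item i); rewrite //= inE. Qed.

Let label_uniq (i j : pj_node P) x : x \in pj_pi i -> x \in pj_pi j -> i = j.
Proof.
have lt_disjoint (a b : 'I_(size (store st))) :
    a < b -> [disjoint item_pi (item a) & item_pi (item b)].
  move=> ab; have /(pairwiseP set0)/(_ a b) := ext_disjoint E.
  by rewrite !inE !size_map !ltn_ord !(nth_map (LeafItem set0)) ?ltn_ord //; apply.
move=> xi xj; apply/val_inj; case: (ltngtP (val i) (val j)) => // /lt_disjoint.
  by rewrite -setI_eq0 => /eqP/setP/(_ x); rewrite !inE xi xj.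
by rewrite -setI_eq0 => /eqP/setP/(_ x); rewrite !inE xi xj.
Qed.

Let label_neq0 (i : pj_node P) : i \notin pj_leaves P -> exists x, x \in pj_pi i.
Proof.
move=> /item_internal[ch iE]; have := item_okP i; rewrite iE /= => /and4P[_ A0 _ _].
exact/set0Pn.
Qed.

Let gamma_image (c : clause X) :
  c \in phi -> exists2 i : pj_node P, i \in pj_leaves P & pj_gamma i = c.
Proof.
move=> cphi; have := ext_clauses E c; rewrite (ext_found E) cov !inE cphi /=.
case/(mem_flatten_map _ (LeafItem set0)) => k kn.
case kE: (nth _ _ k) => [c'|] //=; rewrite inE => /eqP cc'.
exists (Ordinal kn : pj_node P); first by rewrite leavesE /item /= kE.
by rewrite /= kE.
Qed.

Let gamma_phi (i : pj_node P) : i \in pj_leaves P -> pj_gamma i \in phi.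
Proof.
move=> /item_leaf iE.
suff: pj_gamma i \in found st :\: set0 by rewrite (ext_found E) cov !inE.
rewrite -(ext_clauses E); apply/(mem_flatten_map _ (LeafItem set0)).
by exists (val i); rewrite ?ltn_ord // [nth _ _ _]iE inE.
Qed.

(** The bound of a child is covered by the bound and the label of its parent, and the bound of the
    root is empty; the induction goes down from the root. *)
Let label_above (i : pj_node P) x :
  x \in B (val i) -> exists2 a : pj_node P, x \in pj_pi a & connect p a i.
Proof.
move: i; apply: (parent_ind p_rk p_ex).
  have := ext_roots E; rewrite /= andbT => /subsetP rB /rB; by rewrite inE.
move=> a b ab IH xb; have := item_okP a; have ab' := ab; rewrite /p /= in ab'.
case aE: (item a) ab' => //= [A ch] bch /and4P[_ _ /allP/(_ _ bch) /andP[_ /subsetP bA] _].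
have := bA x xb; rewrite inE => /orP[/IH[c xc ca] | xA].
  by exists c => //; apply: connect_trans ca (connect1 ab).
by exists a; [rewrite /= -/(item a) aE | exact: connect1].
Qed.

Let leaf_label (i : pj_node P) x :
  i \in pj_leaves P -> x \in clause_vars (pj_gamma i) ->
  exists2 a : pj_node P, x \in pj_pi a & connect p a i.
Proof.
move=> /item_leaf iE xi; apply: label_above.
have := item_okP i; rewrite iE /= => /andP[/subsetP iB _]; exact: iB.
Qed.

Lemma output_project_join_tree : project_join_tree P phi.
Proof.
split.
- exact: (parent_is_tree p_rk p_uniq p_ex).
- split.
    move=> i j il jl ij; apply/val_inj.
    apply: (uniq_flatten_map (ext_uniq E) (ltn_ord i) (ltn_ord j)
      (x0 := LeafItem set0) (y := pj_gamma i)).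
      by rewrite [nth _ _ _](item_leaf il) inE.
    by rewrite [nth _ _ _](item_leaf jl) inE ij.
  apply/setP => c; apply/imsetP/idP => [[i il ->] | /gamma_image[i il <-]].
    exact: gamma_phi.
  by exists i.
- split.
    (* Labels are nonempty and disjoint, so equal labels belong to one node. *)
    move=> i j; rewrite inE => /label_neq0[x xi] _ ij.
    by apply: (label_uniq xi); rewrite -ij.
  apply/and3P; split.
  + apply/eqP/setP => x; rewrite inE.
    have : x \in cnf_vars phi by rewrite hX.
    case/bigcupP => c /gamma_image[i il <-] /(leaf_label il)[a xa _].
    apply/bigcupP; exists (pj_pi a) => //; apply: imset_f.
    by rewrite inE (internal_label xa).
  + apply/trivIsetP => _ _ /imsetP[i _ ->] /imsetP[j _ ->]; apply: contraNT.
    rewrite -setI_eq0 => /set0Pn[x]; rewrite inE => /andP[xi xj].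
    by rewrite (label_uniq xi xj).
  + apply/negP => /imsetP[i]; rewrite inE => /label_neq0[x xi] i0.
    by rewrite -i0 inE in xi.
(* Some label above [l] contains [x], and it can only be that of [n]. *)
move=> n l x _ xn ll xl; have [a xa al] := leaf_label ll xl.
rewrite (label_uniq xn xa); rewrite -(parent_descendant p_rk p_uniq p_ex p_root) in al.
exact: al.
Qed.

(** This holds at every depth, as exhausted recursion yields the empty set. The variables of the
    children lie in the bound and label of their parent, and the label is removed. *)
Let vars_sub d (i : pj_node P) : pj_vars_rec d i \subset B (val i).
Proof.
elim: d i => [|d IH] i /=; first exact: sub0set.
have iok := item_okP i.
case: ifPn => [/item_leaf iE | /item_internal[ch iE]]; rewrite iE /= in iok.
  by case/andP: iok.
case/and4P: iok => _ _ /allP chok _.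
rewrite subDset setUC; apply/bigcupsP => j; rewrite childrenE /p /= iE => /chok/andP[_].
exact: subset_trans (IH j).
Qed.

Lemma output_width : pj_width P <= W.
Proof.
apply/bigmax_leqP => i _; rewrite /pj_size; have iok := item_okP i.
have vs := vars_sub #|{: pj_node P}| i.
case: ifPn => [/item_leaf iE | /item_internal[ch iE]]; rewrite iE /= in iok.
  by case/andP: iok => _; apply: leq_trans; apply: subset_leq_card.
case/and4P: iok => _ _ _; apply: leq_trans; apply: subset_leq_card; exact: setSU.
Qed.

End OutputTree.

Theorem theorem4 (X : finType) (phi : cnf X) (hX : cnf_vars phi = [set: X])
  (S : finType) (eS : rel S) (chi : S -> {set X}) (w : int)
  (hS : tree_decomposition (gaifman phi) eS chi)
  (hw : td_width chi = w)
  (s : S)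
  (sched : S -> seq S)
  (hsched : forall n : S, perm_eq (sched n) (enum (children eS s n))) :
  (chi s != set0 ->
     exists P : pjtree X, td_algorithm phi chi sched s = Some P) /\
  (forall P : pjtree X, td_algorithm phi chi sched s = Some P ->
     project_join_tree P phi /\ ((pj_width P)%:Z <= w + 1)%R).
Proof.
split; first exact: td_algorithm_some hS hsched hX.
move=> P; have := process_root hS hsched; rewrite /td_algorithm.
case: process => [[|r [|]] st] //= [B [new E]].
case: insubP => //= r' _ rE [<-].
(* The initial store is empty, so the new items are the whole store and their positions are the
   nodes. *)
have newE : new = store st by rewrite (ext_store E).
rewrite newE -rE in E; have cov := covered_bags s hS.
split; first exact: output_project_join_tree E cov hX.
(* Subtraction is in the integers, so [w + 1] is exactly the largest bag size, even when all bags
   are empty. *)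
rewrite -hw /td_width GRing.subrK lez_nat.
exact: output_width E.
Qed.
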